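(* Let $G$ be a simple connected undirected graph with $n\ge 2$ vertices and average resistance degrees $\overline{R}_1,\dots,\overline{R}_n$. Then $$\rho_1(G)\le\max_{i\ne j}\sqrt{\overline{R}_i\,\overline{R}_j},$$ and equality holds if and only if $G$ is pseudo resistance regular.
   Context: For a connected graph $G$ with vertices $v_1,\dots,v_n$, Laplacian matrix $L$ (degree matrix minus adjacency matrix) and Moore-Penrose inverse $L^\dagger=(l^\dagger_{ij})$, the resistance distance is $r_{ij}=l^\dagger_{ii}+l^\dagger_{jj}-2l^\dagger_{ij}$, and the resistance distance matrix is $R(G)=(r_{ij})_{n\times n}$. The resistance degrees are $R_i=\sum_{j=1}^n r_{ij}$, the second resistance degrees are $T_i=\sum_{j=1}^n r_{ij}R_j$, and the average resistance degrees are $\overline{R}_i=T_i/R_i$. $G$ is pseudo resistance regular if there is a constant $k$ with $T_i/R_i=k$ for all $i$. The resistance spectral radius $\rho_1(G)$ is the largest eigenvalue of $R(G)$ (equivalently, the maximum of the absolute values of its eigenvalues). The maximum is over $i,j\in\{1,\dots,n\}$ with $i\ne j$. *)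

(* Defs.v *)
From HB Require Import structures.
From mathcomp Require Import all_boot all_order all_algebra.
From mathcomp Require Import boolp classical_sets reals.

Set Implicit Arguments.
Unset Strict Implicit.
Unset Printing Implicit Defensive.

Import Order.TTheory GRing.Theory Num.Theory.

Local Open Scope classical_set_scope.
Local Open Scope ring_scope.

Section MoorePenrose.
Variables (R : realType) (n : nat).
Implicit Types A X : 'M[R]_n.

Definition is_moore_penrose A X : Prop :=
  [/\ A *m X *m A = A, X *m A *m X = X,
      (A *m X)^T = A *m X & (X *m A)^T = X *m A].

(* The default value 0 is never used: see moore_penroseP and
   moore_penrose_unique. *)
Definition moore_penrose A : 'M[R]_n := xget 0 [set X | is_moore_penrose A X].

Lemma moore_penrose_unique A X Y :
  is_moore_penrose A X -> is_moore_penrose A Y -> X = Y.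
Proof.
move=> [AXA XAX AXt XAt] [AYA YAY AYt YAt].
have eAX : A *m X = A *m Y.
  rewrite -[LHS]AXt -{1}AYA -(mulmxA (A *m Y)) trmx_mul AXt AYt.
  by rewrite mulmxA AXA.
have eXA : X *m A = Y *m A.
  rewrite -[LHS]XAt -{1}AYA mulmxA mulmxA -(mulmxA (X *m A)) trmx_mul XAt YAt.
  by rewrite -!mulmxA (mulmxA A X A) AXA.
by rewrite -XAX eXA -mulmxA eAX mulmxA YAY.
Qed.

Lemma row_free_gram m p (F : 'M[R]_(m, p)) :
  row_free F -> F *m F^T \in unitmx.
Proof.
move=> Ffree; rewrite -row_free_unit; apply: inj_row_free => v vFF.
apply: (row_free_inj Ffree); rewrite mul0mx.
have : (v *m F) *m (v *m F)^T = 0.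
  by rewrite trmx_mul mulmxA -(mulmxA v) vFF mul0mx.
move/matrixP/(_ 0 0); rewrite !mxE => /eqP; rewrite psumr_eq0; last first.
  by move=> j _; rewrite [X in _ * X]mxE -expr2 sqr_ge0.
move=> /allP sq0; apply/matrixP => i j; rewrite ord1 [RHS]mxE.
have := sq0 j (mem_index_enum j).
by rewrite /= [X in _ * X]mxE -expr2 sqrf_eq0 => /eqP.
Qed.

Lemma full_rank_moore_penrose r (C : 'M[R]_(n, r)) (F : 'M[R]_(r, n)) :
  row_full C -> row_free F ->
  is_moore_penrose (C *m F)
    (F^T *m invmx (F *m F^T) *m (invmx (C^T *m C) *m C^T)).
Proof.
move=> Cfull Ffree.
have FU : F *m F^T \in unitmx by exact: row_free_gram.
have CU : C^T *m C \in unitmx.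
  have := @row_free_gram _ _ C^T; rewrite trmxK; apply.
  by rewrite /row_free mxrank_tr.
set Cp := _ *m C^T; set Fp := F^T *m _.
have CpC : Cp *m C = 1%:M by rewrite /Cp -mulmxA mulVmx.
have FFp : F *m Fp = 1%:M by rewrite /Fp mulmxA mulmxV.
have AX : C *m F *m (Fp *m Cp) = C *m Cp.
  by rewrite mulmxA -(mulmxA C) FFp mulmx1.
have XA : Fp *m Cp *m (C *m F) = Fp *m F.
  by rewrite mulmxA -(mulmxA Fp) CpC mulmx1.
split.
- by rewrite AX mulmxA -(mulmxA C) CpC mulmx1.
- by rewrite XA mulmxA -(mulmxA Fp) FFp mulmx1.
- by rewrite AX /Cp !trmx_mul trmxK trmx_inv trmx_mul trmxK mulmxA.
- by rewrite XA /Fp !trmx_mul trmxK trmx_inv trmx_mul trmxK mulmxA.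
Qed.

Lemma moore_penroseP A : is_moore_penrose A (moore_penrose A).
Proof.
apply: (@xgetPex _ 0 [set X | is_moore_penrose A X]).
have := full_rank_moore_penrose (col_base_full A) (row_base_free A).
by rewrite mulmx_base => mpA; eexists; exact: mpA.
Qed.

End MoorePenrose.

(* A graph on the vertex set 'I_n is given by its adjacency relation e. *)
Definition connected_graph n (e : rel 'I_n) : Prop :=
  forall i j, connect e i j.

Section ResistanceDistance.
Variables (R : realType) (n : nat) (e : rel 'I_n).

Definition degree (i : 'I_n) : nat := #|[set j | e i j]%SET|.

Definition adjacency_mx : 'M[R]_n := \matrix_(i, j) (e i j)%:R.

Definition degree_mx : 'M[R]_n := diag_mx (\row_i (degree i)%:R).

Definition laplacian_mx : 'M[R]_n := degree_mx - adjacency_mx.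

Definition resistance_distance (i j : 'I_n) : R :=
  let Ld := moore_penrose laplacian_mx in Ld i i + Ld j j - 2 * Ld i j.

Definition resistance_mx : 'M[R]_n := \matrix_(i, j) resistance_distance i j.

Definition resistance_degree (i : 'I_n) : R :=
  \sum_(j < n) resistance_distance i j.

Definition second_resistance_degree (i : 'I_n) : R :=
  \sum_(j < n) resistance_distance i j * resistance_degree j.

Definition average_resistance_degree (i : 'I_n) : R :=
  second_resistance_degree i / resistance_degree i.

Definition pseudo_resistance_regular : Prop :=
  exists k : R, forall i, average_resistance_degree i = k.

(* resistance_mx is real symmetric, so for n > 0 its set of real eigenvalues
   is finite and nonempty, and the supremum is the largest eigenvalue. *)
Definition resistance_spectral_radius : R :=
  sup [set a : R | eigenvalue resistance_mx a].

End ResistanceDistance.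

(* Main.v *)
Require Import Defs.
From mathcomp Require Import all_boot all_order all_algebra.
From mathcomp Require Import boolp classical_sets reals polyrcf ring.

(** Write [r i j] for the resistance distance and [Rd i] for the resistance
degree.

The quantity [r i j] is the quadratic form of the Laplacian [L] at the vector
[(e_i - e_j) L^+].  That form is a sum of squares [(x_i - x_j)^2] over the
edges, so it is nonnegative and, the graph being connected, vanishes only at
constant vectors; hence [r i j > 0] whenever [i != j], while [r i i = 0]
([resistance_distance_gt0], [resistance_distancexx]).

Conjugating the resistance matrix by the diagonal matrix of the [Rd i] gives
the matrix [b i j = r i j * Rd j / Rd i], whose row sums are the average
resistance degrees [s i].  If [a] is an eigenvalue, the vector [z] of absolute
values of an eigenvector of [b] satisfies [|a| z_i <= sum_j b i j z_j].  Let
[z_p] be its largest entry and [z_q] the largest of the other ones.  As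
[b i i = 0], rows [p] and [q] give [|a| z_p <= s p * z_q] and
[|a| z_q <= s q * z_p], hence [a^2 <= s p * s q] with [p != q]
([subinvariant_sqr_le]), which is the bound.

If the bound is attained, it is itself an eigenvalue ([sup_eigenvalue]) and
all these inequalities are equalities.  Then, in the presence of a third
index, [z] is constant, so that every row sum is at least the eigenvalue;
since a product of two of them is at most its square, they are all equal to it
([subinvariant_row_sums_eq]).  A graph on two vertices is always pseudo
resistance regular ([pseudo_resistance_regular2]).  Conversely, if all average
resistance degrees equal [k], then the vector of resistance degrees is an
eigenvector for [k], and [k] is the bound. *)

Set Implicit Arguments.
Unset Strict Implicit.
Unset Printing Implicit Defensive.

Import Order.TTheory GRing.Theory Num.Theory.

Local Open Scope ring_scope.

(** * Suprema of sets of eigenvalues *)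

Section SpectralSup.
Variable R : realType.

Lemma seq_has_max (s : seq R) :
  s != [::] -> exists2 m, m \in s & forall a, a \in s -> a <= m.
Proof.
elim: s => [//|x s IHs] _.
have [-> | s_neq0] := eqVneq s [::].
  by exists x => [|a]; rewrite mem_seq1 // => /eqP ->.
have [m ms m_max] := IHs s_neq0.
have [xm|mx] := leP x m.
  exists m => [|a]; first by rewrite in_cons ms orbT.
  by rewrite in_cons => /predU1P[-> //|]; apply: m_max.
exists x => [|a]; first by rewrite mem_head.
by rewrite in_cons => /predU1P[-> //|/m_max am]; apply: le_trans am (ltW mx).
Qed.

(** The supremum of a nonempty set of eigenvalues is attained, since this set
    is the finite set of roots of the characteristic polynomial. *)
Lemma sup_eigenvalue n (A : 'M[R]_n) :
  (exists a, eigenvalue A a) ->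
  eigenvalue A (sup [set a | eigenvalue A a]%classic).
Proof.
move=> [a0 Aa0].
have eigE a : eigenvalue A a = (a \in rootsR (char_poly A)).
  rewrite -roots_on_rootsR ?inE ?eigenvalue_root_char //.
  by rewrite monic_neq0 ?char_poly_monic.
have [|m] := @seq_has_max (rootsR (char_poly A)).
  by apply: contraTneq Aa0 => s0; rewrite eigE s0.
rewrite -eigE => Am m_max.
have m_ub : ubound [set a | eigenvalue A a]%classic m.
  by move=> a /=; rewrite eigE; apply: m_max.
suff -> : sup [set a | eigenvalue A a]%classic = m by [].
apply/le_anti/andP; split; first by apply: ge_sup => //; exists a0.
by apply: ub_le_sup => //; exists m.
Qed.

End SpectralSup.

(** * The two largest entries of a subinvariant vector *)

Section TwoLargestEntries.
Variables (R : realDomainType) (n : nat).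

Lemma two_largest_entries (z : 'I_n -> R) : (2 <= n)%N ->
  exists p q, [/\ p != q, forall j, z j <= z p & forall j, j != p -> z j <= z q].
Proof.
move=> n_ge2; have i0 : 'I_n by apply: (@Ordinal n 0); apply: ltnW.
have [p _ p_max] := @arg_maxP _ _ _ i0 xpredT z isT.
have [q0 q0p] : exists q0, q0 != p.
  have : (0 < #|predC1 p|)%N by rewrite cardC1 card_ord; case: n n_ge2 => [|[]].
  by move=> /card_gt0P[q0]; rewrite inE; exists q0.
have [q qp q_max] := @arg_maxP _ _ _ q0 (fun j => j != p) z q0p.
by exists p, q; rewrite eq_sym; split=> // j; apply: p_max.
Qed.

Variables (b : 'I_n -> 'I_n -> R) (z : 'I_n -> R) (l : R).
Hypotheses (n_ge2 : (2 <= n)%N).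
Hypotheses (b_diag : forall i, b i i = 0) (b_gt0 : forall i j, i != j -> 0 < b i j).
Hypotheses (z_ge0 : forall i, 0 <= z i) (z_neq0 : exists i, z i != 0).
Hypothesis (l_ge0 : 0 <= l).
Hypothesis (z_sub : forall i, l * z i <= \sum_j b i j * z j).

Let s i := \sum_j b i j.

Let b_ge0 i j : 0 <= b i j.
Proof. by have [->|/b_gt0/ltW//] := eqVneq i j; rewrite b_diag. Qed.

(** As [b i i = 0], the entry [z i] itself does not contribute to row [i], so
    that a bound on the other entries suffices. *)
Let row_le i c : (forall j, j != i -> z j <= c) -> \sum_j b i j * z j <= s i * c.
Proof.
move=> zc; rewrite mulr_suml; apply: ler_sum => j _.
have [->|ji] := eqVneq j i; first by rewrite b_diag !mul0r.
by rewrite ler_wpM2l ?zc.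
Qed.

(** In the equality case of [row_le], all entries but [z i] reach the bound,
    because the off-diagonal coefficients are positive. *)
Let row_eq i c : (forall j, j != i -> z j <= c) -> s i * c <= \sum_j b i j * z j ->
  forall j, j != i -> z j = c.
Proof.
move=> zc le_row j ji.
have ge0 k : true -> 0 <= b i k * (c - z k).
  move=> _; have [->|ki] := eqVneq k i; first by rewrite b_diag mul0r.
  by rewrite mulr_ge0 ?subr_ge0 ?zc.
have : \sum_k b i k * (c - z k) = 0.
  apply/le_anti; rewrite sumr_ge0 // andbT.
  under eq_bigr do rewrite mulrBr.
  by rewrite sumrB -mulr_suml subr_le0.
move=> /(psumr_eq0P ge0)/(_ j isT)/eqP; rewrite mulf_eq0 subr_eq0.
by rewrite gt_eqF ?b_gt0 1?eq_sym //= => /eqP.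
Qed.

Let max_gt0 p : (forall j, z j <= z p) -> 0 < z p.
Proof.
move=> p_max; have [i zi] := z_neq0.
by apply: lt_le_trans (p_max i); rewrite lt_def zi z_ge0.
Qed.

Lemma subinvariant_sqr_le : exists p q, p != q /\ l ^+ 2 <= s p * s q.
Proof.
have [p [q [pq p_max q_max]]] := two_largest_entries z n_ge2.
exists p, q; split=> //.
have zp : 0 < z p by apply: max_gt0.
have sp : 0 <= s p by apply: sumr_ge0.
have le_p : l * z p <= s p * z q by apply: le_trans (row_le q_max).
have le_q : l * z q <= s q * z p.
  by apply: le_trans (row_le (fun j _ => p_max j)).
rewrite -(ler_pM2r zp) expr2 -!mulrA.
apply: le_trans (ler_wpM2l l_ge0 le_p) _.
by rewrite mulrCA ler_wpM2l.
Qed.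

(** The condition [2 < n] is needed: the matrix with rows [(0, 4)] and [(1, 0)]
    has the eigenvalue 2 and the row sums 4 and 1. *)
Lemma subinvariant_row_sums_eq : (2 < n)%N -> 0 < l ->
  (forall i j, i != j -> s i * s j <= l ^+ 2) -> forall i, s i = l.
Proof.
move=> n_gt2 l_gt0 s_le.
have [p [q [pq p_max q_max]]] := two_largest_entries z n_ge2.
have zp : 0 < z p by apply: max_gt0.
have le_p : l * z p <= s p * z q by apply: le_trans (row_le q_max).
have le_q : l * z q <= s q * z p.
  by apply: le_trans (row_le (fun j _ => p_max j)).
have zq : 0 < z q.
  rewrite lt_def z_ge0 andbT; apply: contraTneq le_p => ->.
  by rewrite mulr0 -ltNge mulr_gt0.
have lzp : 0 < l * z p by rewrite mulr_gt0.
have lzq : 0 < l * z q by rewrite mulr_gt0.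
have prod_le : (s p * z q) * (s q * z p) <= (l * z p) * (l * z q).
  rewrite mulrACA [leRHS]mulrACA -expr2 (mulrC (z q)).
  by rewrite ler_wpM2r ?s_le // mulr_ge0.
(* As [s p * s q <= l ^ 2], [le_p] and [le_q] cannot be strict. *)
have eq_p : s p * z q <= l * z p.
  rewrite leNgt; apply: contraTN prod_le => lt_p; rewrite -ltNge.
  apply: lt_le_trans (_ : (s p * z q) * (l * z q) <= _).
    by rewrite ltr_pM2r.
  by rewrite ler_pM2l // (lt_trans lzp).
have eq_q : s q * z p <= l * z q.
  rewrite leNgt; apply: contraTN prod_le => lt_q; rewrite -ltNge.
  apply: lt_le_trans (_ : (l * z p) * (s q * z p) <= _).
    by rewrite ltr_pM2l.
  by rewrite ler_pM2r // (lt_trans lzq).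
have z_p := row_eq q_max (le_trans eq_p (z_sub p)).
have z_q := row_eq (fun j _ => p_max j) (le_trans eq_q (z_sub q)).
(* A third index links [z p] and [z q], so that [z] is constant. *)
have zpq : z p = z q.
  have : (0 < #|~: [set p; q]|)%N.
    by rewrite cardsCs finset.setCK card_ord cards2 pq subn_gt0.
  move=> /card_gt0P[k]; rewrite !inE negb_or => /andP[kp kq].
  by rewrite -(z_p k kp) (z_q k kq).
have zE j : z j = z p.
  by have [-> //|/z_p ->] := eqVneq j p.
have l_le i : l <= s i.
  rewrite -(ler_pM2r zp) -{1}(zE i); apply: le_trans (z_sub i) _.
  by apply: row_le => j _; rewrite zE.
move=> i; apply/le_anti; rewrite l_le andbT.
have [j ij] : exists j, i != j.
  by have [->|] := eqVneq i p; [exists q | exists p].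
rewrite -(ler_pM2r l_gt0) -expr2; apply: le_trans (s_le i j ij).
by rewrite ler_wpM2l // (le_trans l_ge0).
Qed.

End TwoLargestEntries.

(** * Positivity of the resistance distance *)

Section Resistance.
Variables (R : realType) (n : nat) (e : rel 'I_n).
Hypotheses (e_sym : symmetric e) (e_conn : connected_graph e).

Let L := laplacian_mx R e.
Let Ld := moore_penrose L.

Lemma laplacian_mxE i j :
  L i j = (degree e i)%:R *+ (i == j) - (e i j)%:R.
Proof. by rewrite !mxE. Qed.

Lemma laplacian_mx_sym : L^T = L.
Proof.
apply/matrixP => i j; rewrite mxE !laplacian_mxE e_sym.
by have [->|] := eqVneq i j.
Qed.

(** The transpose of the Moore-Penrose inverse of [L] is a Moore-Penrose
    inverse of [L^T = L], and there is only one. *)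
Lemma moore_penrose_laplacian_sym : Ld^T = Ld.
Proof.
have [LXL XLX LX XL] := moore_penroseP L.
apply: (@moore_penrose_unique _ _ L) (moore_penroseP L); rewrite -/Ld in LXL XLX LX XL *.
split.
- by rewrite -[RHS]laplacian_mx_sym -[in RHS]LXL !trmx_mul laplacian_mx_sym mulmxA.
- by rewrite -[in RHS]XLX !trmx_mul laplacian_mx_sym mulmxA.
- by rewrite -{1 2}laplacian_mx_sym -trmx_mul XL.
- by rewrite -{1 2}laplacian_mx_sym -trmx_mul LX.
Qed.

Lemma degreeE i : (degree e i)%:R = \sum_j (e i j)%:R :> R.
Proof.
rewrite /degree -sum1_card natr_sum big_mkcond /=.
by apply: eq_bigr => j _; rewrite inE; case: (e i j).
Qed.

(** The Dirichlet form; each edge is counted in both directions, whence the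
    factor 2. *)
Lemma laplacian_quadratic_form (x : 'rV[R]_n) :
  (x *m L *m x^T) 0 0 *+ 2 = \sum_i \sum_j (e i j)%:R * (x 0 i - x 0 j) ^+ 2.
Proof.
have -> : (x *m L *m x^T) 0 0 =
    \sum_i \sum_j (e i j)%:R * (x 0 i ^+ 2 - x 0 i * x 0 j).
  rewrite mxE; apply: eq_bigr => j _.
  rewrite !mxE.
  under eq_bigr do rewrite laplacian_mxE mulrBr.
  rewrite sumrB (bigD1 j) //= eqxx mulr1n big1 ?addr0; last first.
    by move=> i /negPf ->; rewrite mulr0n mulr0.
  rewrite degreeE mulr_sumr -sumrB mulr_suml.
  by apply: eq_bigr => i _; rewrite (e_sym i j); ring.
rewrite mulr2n {2}exchange_big -big_split; apply: eq_bigr => i _ /=.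
rewrite -big_split; apply: eq_bigr => j _ /=.
by rewrite (e_sym j i); ring.
Qed.

Lemma laplacian_form_ge0 (x : 'rV[R]_n) : 0 <= (x *m L *m x^T) 0 0.
Proof.
rewrite -(pmulrn_lge0 _ (isT : 0 < 2)%N) laplacian_quadratic_form.
by apply: sumr_ge0 => i _; apply: sumr_ge0 => j _; rewrite mulr_ge0 ?sqr_ge0.
Qed.

Lemma laplacian_form_eq0 (x : 'rV[R]_n) :
  (x *m L *m x^T) 0 0 = 0 -> forall i j, x 0 i = x 0 j.
Proof.
move=> xLx0.
have := laplacian_quadratic_form x; rewrite xLx0 mul0rn => /esym sum0.
have x_edge i j : e i j -> x 0 i = x 0 j.
  move=> eij.
  have term_ge0 k m : true -> 0 <= (e k m)%:R * (x 0 k - x 0 m) ^+ 2.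
    by rewrite mulr_ge0 ?sqr_ge0.
  have row0 := psumr_eq0P (fun k _ => sumr_ge0 _ (term_ge0 k)) sum0 (i := i) isT.
  have /eqP := psumr_eq0P (term_ge0 i) row0 (i := j) isT.
  by rewrite eij mul1r sqrf_eq0 subr_eq0 => /eqP.
move=> i j; have /connectP[p] := e_conn i j.
elim: p i => [i _ -> //|k p IHp i /= /andP[/x_edge -> ekp] jE].
exact: IHp.
Qed.

Lemma const_mul_laplacian (x : 'rV[R]_n) :
  (forall i j, x 0 i = x 0 j) -> x *m L = 0.
Proof.
move=> x_const; apply/rowP => j; rewrite !mxE.
under eq_bigr do rewrite (x_const _ j) laplacian_mxE.
rewrite -mulr_sumr sumrB (bigD1 j) //= eqxx big1 ?addr0; last first.
  by move=> i /negPf ->.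
rewrite mulr1n degreeE; under eq_bigr do rewrite e_sym.
by rewrite subrr mulr0.
Qed.

Lemma resistance_distancexx i : resistance_distance R e i i = 0.
Proof. by rewrite /resistance_distance; ring. Qed.

Lemma resistance_distanceC i j :
  resistance_distance R e i j = resistance_distance R e j i.
Proof.
rewrite /resistance_distance -/L -/Ld -[in LHS]moore_penrose_laplacian_sym !mxE.
by ring.
Qed.

(** The vector [e_i - e_j]. *)
Let d i j : 'rV[R]_n := delta_mx 0 i - delta_mx 0 j.

Lemma resistance_distance_form i j :
  resistance_distance R e i j = (d i j *m Ld *m L *m (d i j *m Ld)^T) 0 0.
Proof.
have [_ LdLLd _ _] := moore_penroseP L.
rewrite trmx_mul moore_penrose_laplacian_sym !mulmxA.
rewrite -2!(mulmxA (d i j)) LdLLd.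
rewrite /d linearB /= !trmx_delta mulmxBr -!colE mulmxBl -!rowE.
have Ldji : Ld j i = Ld i j by rewrite -[in LHS]moore_penrose_laplacian_sym mxE.
by rewrite /resistance_distance -/L -/Ld !mxE Ldji; ring.
Qed.

Lemma resistance_distance_gt0 i j : i != j -> 0 < resistance_distance R e i j.
Proof.
move=> ij; rewrite lt_def resistance_distance_form laplacian_form_ge0 andbT.
apply: contra_neq ij => /laplacian_form_eq0/const_mul_laplacian dLdL.
have [LLdL _ _ LdLt] := moore_penroseP L.
(* [Ld *m L] is symmetric, so that [L = Ld *m L *m L]. *)
have dL : d i j *m L = 0.
  rewrite -[L]laplacian_mx_sym -LLdL -mulmxA trmx_mul LdLt laplacian_mx_sym.
  by rewrite !mulmxA dLdL mul0mx.
have := @laplacian_form_eq0 (d i j); rewrite dL mul0mx mxE => /(_ erefl i j).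
rewrite !mxE !eqxx; have [//|_] := eqVneq i j.
by rewrite subr0 sub0r => /esym/eqP; rewrite eqNr oner_eq0.
Qed.

End Resistance.

(** * The bound *)

Section Bound.
Variables (R : realType) (n : nat) (e : rel 'I_n).
Hypotheses (n_ge2 : (2 <= n)%N) (e_sym : symmetric e) (e_conn : connected_graph e).

Let r := resistance_distance R e.
Let Rd := resistance_degree R e.
Let avg := average_resistance_degree R e.

(** The entries of [D^-1 * resistance_mx * D], where [D] is the diagonal
    matrix of the resistance degrees. *)
Let b i j := r i j * Rd j / Rd i.

Let r_ge0 i j : 0 <= r i j.
Proof.
have [->|ij] := eqVneq i j; first by rewrite /r resistance_distancexx.
exact/ltW/resistance_distance_gt0.
Qed.

Lemma exists_neq (i : 'I_n) : exists j, i != j.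
Proof.
have : (0 < #|predC1 i|)%N by rewrite cardC1 card_ord -ltnS prednK // ltnW.
by move=> /card_gt0P[j]; rewrite inE eq_sym; exists j.
Qed.

Lemma resistance_degree_gt0 i : 0 < Rd i.
Proof.
have [j ij] := exists_neq i.
rewrite /Rd /resistance_degree (bigD1 j) //= ltr_wpDr ?sumr_ge0 //.
exact: resistance_distance_gt0.
Qed.

Let b_diag i : b i i = 0.
Proof. by rewrite /b /r resistance_distancexx !mul0r. Qed.

Let b_gt0 i j : i != j -> 0 < b i j.
Proof.
move=> ij; rewrite divr_gt0 ?mulr_gt0 ?resistance_degree_gt0 //.
exact: resistance_distance_gt0.
Qed.

Lemma average_resistance_degreeE i : avg i = \sum_j b i j.
Proof. by rewrite /avg /average_resistance_degree mulr_suml. Qed.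

Lemma average_resistance_degree_gt0 i : 0 < avg i.
Proof.
rewrite average_resistance_degreeE; have [j ij] := exists_neq i.
rewrite (bigD1 j) //= ltr_wpDr ?b_gt0 // sumr_ge0 // => k _.
by rewrite divr_ge0 ?mulr_ge0 // ltW ?resistance_degree_gt0.
Qed.

(** The vector [z] consists of the absolute values of the entries of an
    eigenvector, divided by the resistance degrees. *)
Lemma eigenvalue_subinvariant a : eigenvalue (resistance_mx R e) a ->
  exists z : 'I_n -> R, [/\ forall i, 0 <= z i, exists i, z i != 0 &
    forall i, `|a| * z i <= \sum_j b i j * z j].
Proof.
move=> /eigenvalueP[v vM v_neq0]; exists (fun i => `|v 0 i| / Rd i).
have Rd_neq0 i : Rd i != 0 by rewrite gt_eqF ?resistance_degree_gt0.
split=> [i||i].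
- by rewrite divr_ge0 // ltW ?resistance_degree_gt0.
- have /rV0Pn[i vi] := v_neq0; exists i.
  by rewrite mulf_neq0 ?invr_eq0 ?normr_eq0.
have -> : \sum_j b i j * (`|v 0 j| / Rd j) = (\sum_j r i j * `|v 0 j|) / Rd i.
  rewrite mulr_suml; apply: eq_bigr => j _; rewrite /b.
  by field; rewrite !Rd_neq0.
rewrite mulrA ler_pM2r ?invr_gt0 ?resistance_degree_gt0 // -normrM.
have -> : a * v 0 i = \sum_j r i j * v 0 j.
  move/rowP/(_ i): vM; rewrite !mxE => <-; apply: eq_bigr => j _.
  by rewrite mxE mulrC resistance_distanceC.
apply: le_trans (ler_norm_sum _ _ _) _; apply: ler_sum => j _.
by rewrite normrM ger0_norm.
Qed.

Lemma eigenvalue_sqr_le a : eigenvalue (resistance_mx R e) a ->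
  exists p q, p != q /\ a ^+ 2 <= avg p * avg q.
Proof.
move=> /eigenvalue_subinvariant[z [z_ge0 z_neq0 z_sub]].
have [p [q [pq le_pq]]] :=
  subinvariant_sqr_le n_ge2 b_diag b_gt0 z_ge0 z_neq0 (normr_ge0 a) z_sub.
exists p, q; split=> //.
by rewrite !average_resistance_degreeE -real_normK ?num_real.
Qed.

Lemma average_resistance_degree_eq a : (2 < n)%N -> 0 < a ->
  eigenvalue (resistance_mx R e) a ->
  (forall i j, i != j -> avg i * avg j <= a ^+ 2) -> forall i, avg i = a.
Proof.
move=> n_gt2 a_gt0 /eigenvalue_subinvariant[z [z_ge0 z_neq0 z_sub]] avg_le i.
rewrite average_resistance_degreeE.
rewrite (gtr0_norm a_gt0) in z_sub.
apply: (subinvariant_row_sums_eq n_ge2 b_diag b_gt0 z_ge0 z_neq0 (ltW a_gt0)) => //.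
by move=> k j kj; rewrite -!average_resistance_degreeE avg_le.
Qed.

Lemma eigenvalue_pseudo_regular k : (forall i, avg i = k) ->
  eigenvalue (resistance_mx R e) k.
Proof.
move=> avgE; apply/eigenvalueP; exists (\row_i Rd i).
  apply/rowP => i; rewrite !mxE -(avgE i) /avg /average_resistance_degree.
  rewrite divfK ?gt_eqF ?resistance_degree_gt0 //.
  by apply: eq_bigr => j _; rewrite !mxE mulrC resistance_distanceC.
have i0 : 'I_n by apply: (@Ordinal n 0); apply: ltnW.
by apply/rV0Pn; exists i0; rewrite mxE gt_eqF ?resistance_degree_gt0.
Qed.

End Bound.

(** Both average resistance degrees of the graph on two vertices are equal to
    the resistance distance between them. *)
Lemma pseudo_resistance_regular2 (R : realType) (e : rel 'I_2) :
  symmetric e -> connected_graph e -> pseudo_resistance_regular R e.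
Proof.
move=> e_sym e_conn; exists (resistance_distance R e ord0 ord_max) => i.
have r01 := resistance_distance_gt0 R e_sym e_conn (isT : ord0 != ord_max :> 'I_2).
rewrite /average_resistance_degree /second_resistance_degree /resistance_degree.
rewrite !big_ord_recr !big_ord0 /= !add0r.
have -> : widen_ord (leqnSn 1) ord_max = ord0 :> 'I_2 by apply: val_inj.
rewrite !resistance_distancexx (resistance_distanceC R e_sym ord_max ord0).
have [->|->] : i = ord0 \/ i = ord_max.
- by case: i => [[|[|//]] lt_i]; [left|right]; apply: val_inj.
- by rewrite resistance_distancexx; field; rewrite gt_eqF.
rewrite resistance_distancexx (resistance_distanceC R e_sym ord_max ord0).
by field; rewrite gt_eqF.
Qed.

Theorem theorem4p3 (R : realType) (n : nat) (e : rel 'I_n)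
    (n_ge2 : (2 <= n)%N) (e_sym : symmetric e) (e_irr : irreflexive e)
    (e_conn : connected_graph e) :
  let bound : R :=
    \big[Num.max/0]_(i < n) \big[Num.max/0]_(j < n | i != j)
      Num.sqrt (average_resistance_degree R e i *
                average_resistance_degree R e j) in
  resistance_spectral_radius R e <= bound /\
  (resistance_spectral_radius R e = bound <-> pseudo_resistance_regular R e).
Proof.
move=> bound.
have avg_gt0 := average_resistance_degree_gt0 R n_ge2 e_sym e_conn.
have bound_ge i j : i != j ->
    Num.sqrt (average_resistance_degree R e i *
              average_resistance_degree R e j) <= bound.
  move=> ij; rewrite /bound; apply: (bigmax_sup i) => //.
  exact: (bigmax_sup j).
have bound_gt0 : 0 < bound.
  have i0 : 'I_n by apply: (@Ordinal n 0); apply: ltnW.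
  have [j0 ij0] := exists_neq n_ge2 i0.
  by apply: lt_le_trans (bound_ge _ _ ij0); rewrite sqrtr_gt0 mulr_gt0.
have eig_le a : eigenvalue (resistance_mx R e) a -> a <= bound.
  move=> /(eigenvalue_sqr_le n_ge2 e_sym e_conn)[p [q [pq le_pq]]].
  apply: le_trans (bound_ge _ _ pq); apply: le_trans (ler_norm a) _.
  by rewrite -sqrtr_sqr ler_wsqrtr.
have rho_le : resistance_spectral_radius R e <= bound.
  have [ex_a|no_a] := pselect (exists a, eigenvalue (resistance_mx R e) a).
    exact/eig_le/sup_eigenvalue.
  (* The supremum of the empty set is 0. *)
  rewrite /resistance_spectral_radius sup_out; first exact: ltW.
  by move=> [[a Aa] _]; apply: no_a; exists a.
split=> //; split=> [rhoE|[k avgE]].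
- case: (ltnP 2 n) => [n_gt2|n_le2]; last first.
    have n2 : n = 2%N by apply/eqP; rewrite eqn_leq n_le2.
    by subst n; apply: pseudo_resistance_regular2.
  exists bound; apply: average_resistance_degree_eq => //; last first.
    move=> i j ij; have := bound_ge i j ij.
    rewrite -(ler_sqr (sqrtr_ge0 _) (ltW bound_gt0)).
    by rewrite sqr_sqrtr // mulr_ge0 // ltW.
  rewrite -rhoE; apply: sup_eigenvalue; apply: contrapT => no_a.
  (* Without eigenvalues the supremum would be 0, which is below the bound. *)
  move: bound_gt0; rewrite -rhoE /resistance_spectral_radius sup_out ?ltxx //.
  by move=> [[a Aa] _]; apply: no_a; exists a.
apply/le_anti; rewrite rho_le /=.
have k_gt0 : 0 < k.
  have i0 : 'I_n by apply: (@Ordinal n 0); apply: ltnW.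
  by rewrite -(avgE i0).
have bound_le : bound <= k.
  apply: bigmax_le => [|i _]; first exact: ltW.
  apply: bigmax_le => [|j _]; first exact: ltW.
  by rewrite !avgE -expr2 sqrtr_sqr gtr0_norm.
apply: le_trans bound_le _; apply: ub_le_sup.
  by exists bound => a; apply: eig_le.
exact: eigenvalue_pseudo_regular.
Qed.
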